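(* Let $(X,u_X)$ be a finite ultra-metric space with $n$ points $x_1<x_2<\dots<x_n$ labelled according to a self-consistent order. For any degree $k\ge1$, $$\mathcal{B}_{\mathrm{Ver},k}(X)=\bigsqcup_{2\le i_1<i_2<\dots<i_{k+1}\le n}\left\{u_X(x_{i_1-1},x_{i_{k+1}})\cdot(1,1)\right\}=\bigsqcup_{\substack{1\le i<j\le n\\ j-i\ge k+1}}\left\{u_X(x_i,x_j)\cdot(1,1)\right\}^{\binom{j-i-2}{k-1}}.$$
   Context: Fix a field $\mathbb{F}$. An ultra-metric is a metric satisfying $u_X(x,x'')\le\max\{u_X(x,x'),u_X(x',x'')\}$. Unions $\sqcup$ are multiset unions; $r\cdot(1,1)=(r,r)$; $\{x\}^m$ is the multiset of $m$ copies of $x$. Self-consistent order. An ordering $x_1<\dots<x_n$ of the points of $X$ such that for each $i=2,\dots,n$, $x_i\in X\setminus\{x_1,\dots,x_{i-1}\}$ satisfies $u_X(x_{i-1},x_i)=\min_{x\in X\setminus\{x_1,\dots,x_{i-1}\}}u_X(x_{i-1},x)$ ($x_1$ is arbitrary). Such an ordering is not unique in general. Vietoris–Rips FCC. $C_*(\mathrm{VR}(X))$ is the simplicial chain complex over $\mathbb{F}$ of the full simplex on the vertex set $X$, with filtration function $\ell^X(\sum\lambda_i\sigma_i)=\max_{\lambda_i\ne0}\operatorname{diam}(\sigma_i)$ (distinct simplices $\sigma_i$), $\ell^X(0)=-\infty$. Elements $c_1,\dots,c_r$ are orthogonal if $\ell^X(\sum\lambda_ic_i)=\max_{\lambda_i\ne0}\ell^X(c_i)$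 for all scalars. Verbose barcode. For $k\ge0$, choose orthogonal ordered bases $(y_1,\dots,y_a)$ of $C_{k+1}$ and $(w_1,\dots,w_b)$ of $\ker\partial_k$ such that, with $r=\operatorname{rank}\partial_{k+1}$, $(y_{r+1},\dots,y_a)$ is a basis of $\ker\partial_{k+1}$, $(w_1,\dots,w_r)$ is a basis of $\operatorname{im}\partial_{k+1}$, and $\partial_{k+1}y_i=w_i$ for $i\le r$. The degree-$k$ verbose barcode $\mathcal{B}_{\mathrm{Ver},k}(X)$ is the multiset of pairs $(\ell^X(w_i),\ell^X(y_i))$, $i\le r$, and $(\ell^X(w_i),\infty)$, $r<i\le b$. It does not depend on the choices. *)

(* Defs.v *)
From HB Require Import structures.
From mathcomp Require Export all_boot all_order all_algebra.
From mathcomp Require Export reals constructive_ereal.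
Set Implicit Arguments.
Unset Strict Implicit.
Unset Printing Implicit Defensive.
Import Order.TTheory GRing.Theory Num.Theory.
Local Open Scope ring_scope.

Section UltraMetric.
Variables (R : realType) (X : finType) (u : X -> X -> R).

Definition is_metric : Prop :=
  [/\ forall x y, 0 <= u x y,
      forall x y, u x y = 0 <-> x = y,
      forall x y, u x y = u y x
    & forall x y z, u x z <= u x y + u y z].

Definition is_ultrametric : Prop :=
  is_metric /\ forall x y z, u x z <= Num.max (u x y) (u y z).

(* Points are labelled from 1: only x 1, ..., x n matter, the other values of
   x : nat -> X being irrelevant.  The first condition says that x 1, ..., x n
   lists every point of X exactly once. *)
Definition self_consistent (n : nat) (x : nat -> X) : Prop :=
  perm_eq [seq x i | i <- iota 1 n] (enum X) /\
  forall i : nat, (2 <= i <= n)%N ->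
    forall y : X, y \notin [seq x j | j <- iota 1 i.-1] ->
      u (x i.-1) (x i) <= u (x i.-1) y.

End UltraMetric.

(* Chains of all degrees at once, as coefficient functions on vertex sets.
   The coefficient at set0 plays no role: set0 is not a simplex, and the spaces
   chains F X k below only involve nonempty sets. *)
Notation chain F X := {ffun {set X} -> F^o}.

Section ChainComplex.
Variables (F : fieldType) (X : finType).

Definition simplex_chain (s : {set X}) : chain F X :=
  [ffun t => (t == s)%:R : F^o].

Definition chains (k : nat) : {vspace chain F X} :=
  <<[seq simplex_chain s | s <- enum [set s : {set X} | #|s| == k.+1]]>>%VS.

(* Simplices are oriented by the enumeration order of X; the index of v is its
   position among the vertices of s. *)
Definition vertex_index (s : {set X}) (v : X) : nat :=
  #|[set w in s | (enum_rank w < enum_rank v)%N]|.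

(* The guard 1 < #|s| makes the complex non-augmented: vertices have zero
   boundary. *)
Definition boundary_fun (c : chain F X) : chain F X :=
  \sum_(s : {set X} | (1 < #|s|)%N)
    c s *: \sum_(v in s) (-1) ^+ vertex_index s v *: simplex_chain (s :\ v).

Fact boundary_fun_linear : linear boundary_fun.
Proof.
move=> a c d; rewrite /boundary_fun scaler_sumr -big_split /=.
by apply: eq_bigr => s _; rewrite !ffunE scalerDl scalerA.
Qed.

HB.instance Definition _ :=
  GRing.isLinear.Build F (chain F X) (chain F X) _ boundary_fun
    boundary_fun_linear.

Definition boundary : 'End(chain F X) := linfun boundary_fun.

Definition cycles (k : nat) : {vspace chain F X} :=
  (chains k :&: lker boundary)%VS.

Definition boundaries (k : nat) : {vspace chain F X} :=
  (boundary @: chains k.+1)%VS.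

Variables (R : realType) (u : X -> X -> R).

Definition diam (s : {set X}) : R :=
  \big[Num.max/0]_(p in s) \big[Num.max/0]_(q in s) u p q.

Definition filtration (c : chain F X) : \bar R :=
  \big[maxe/-oo%E]_(s : {set X} | c s != 0) (diam s)%:E.

Definition orthogonal_chains (c : seq (chain F X)) : Prop :=
  forall a : 'I_(size c) -> F,
    filtration (\sum_i a i *: c`_i) =
    \big[maxe/-oo%E]_(i | a i != 0) filtration c`_i.

Definition singular_bases (k : nat) (y w : seq (chain F X)) : Prop :=
  let r := \dim (boundaries k) in
  [/\ basis_of (chains k.+1) y /\ orthogonal_chains y,
      basis_of (cycles k) w /\ orthogonal_chains w,
      basis_of (cycles k.+1) (drop r y),
      basis_of (boundaries k) (take r w)
    & forall i : nat, (i < r)%N -> boundary y`_i = w`_i].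

Definition bars (k : nat) (y w : seq (chain F X)) : seq (\bar R * \bar R) :=
  [seq (filtration w`_i,
        if (i < \dim (boundaries k))%N then filtration y`_i else +oo%E)
  | i <- iota 0 (size w)].

(* Multisets are sequences up to perm_eq: B is a degree-k verbose barcode when
   it is the multiset of bars of some admissible choice of bases. *)
Definition is_verbose_barcode (k : nat) (B : seq (\bar R * \bar R)) : Prop :=
  exists y w : seq (chain F X), singular_bases k y w /\ perm_eq B (bars k y w).

End ChainComplex.

Definition ephemeral_bar (R : realType) (a : R) : \bar R * \bar R :=
  (a%:E, a%:E).

(* Main.v *)
Require Import Defs.
From mathcomp Require Import zify.
Set Implicit Arguments.
Unset Strict Implicit.
Unset Printing Implicit Defensive.
Import Order.TTheory GRing.Theory Num.Theory.
Local Open Scope ring_scope.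

(* Call a simplex "up" if it contains the successor of its first vertex in the
   self-consistent order.  Deleting that successor is a bijection from the up
   simplices to the others (the last point excepted), and in dimension at least
   2 it preserves the diameter, since the successor is a nearest neighbour of the
   first vertex among the later points.  A pivot argument on this matching
   shows that the boundaries of the up (k+1)-simplices form an orthogonal basis
   of the k-cycles and that the boundary preserves the filtration of chains of
   up simplices.  Every bar is therefore of the form (e, e), the multiset of the
   e being the filtration values of any orthogonal basis of the k-cycles, that
   is, the diameters of the up (k+1)-simplices.  By the ultrametric inequality
   such a diameter is the distance from the first vertex to the last one. *)

(** * Spans of simplices and the boundary in coordinates *)

Section SimplexChains.
Variables (F : fieldType) (X : finType).
Implicit Types (c : chain F X) (A s t : {set X}) (S : {set {set X}}).

Lemma simplex_chainE s t : simplex_chain F s t = (t == s)%:R.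
Proof. by rewrite ffunE. Qed.

Lemma chain_sum c : c = \sum_s c s *: simplex_chain F s.
Proof.
apply/ffunP => t; rewrite sum_ffunE (bigD1 t) //= big1 => [|s nts].
  by rewrite ffunE simplex_chainE eqxx addr0 [_ *: _]mulr1.
by rewrite ffunE simplex_chainE eq_sym (negPf nts) scaler0.
Qed.

Definition simplices S : seq (chain F X) :=
  [seq simplex_chain F s | s <- enum S].

Lemma mem_simplices S c :
  reflect (forall s, c s != 0 -> s \in S) (c \in <<simplices S>>%VS).
Proof.
apply: (iffP idP) => [/(@coord_span _ _ _ (in_tuple _)) -> s | Sc].
  apply: contraR => nSs; rewrite sum_ffunE big1 // => i _.
  have /mapP[t] : (in_tuple (simplices S))`_i \in simplices S.
    exact/mem_nth/ltn_ord.
  rewrite mem_enum ffunE => St ->; rewrite simplex_chainE.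
  case: eqP => [e|_]; first by rewrite e St in nSs.
  by rewrite scaler0.
rewrite (chain_sum c); apply: memv_suml => s _.
have [->|/Sc Ss] := eqVneq (c s) 0; first by rewrite scale0r mem0v.
by apply/memvZ/memv_span/map_f; rewrite mem_enum.
Qed.

Lemma sum_simplices S (a : nat -> F) i : (i < size (simplices S))%N ->
  (\sum_(j < size (simplices S)) a j *: (simplices S)`_j) (nth set0 (enum S) i)
  = a i.
Proof.
move=> lti; have szS : size (simplices S) = size (enum S) by rewrite size_map.
rewrite sum_ffunE (bigD1 (Ordinal lti)) //= big1 => [|j].
  by rewrite ffunE (nth_map set0) -?szS // simplex_chainE eqxx addr0 [_ *: _]mulr1.
rewrite -val_eqE /= => ne_ji; rewrite ffunE (nth_map set0) -?szS //.
by rewrite simplex_chainE nth_uniq ?enum_uniq -?szS // eq_sym (negPf ne_ji) scaler0.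
Qed.

Lemma free_simplices S : free (simplices S).
Proof.
apply/(@freeP _ _ _ (in_tuple _)) => a a0 i.
(* Coefficients given on ordinals are extended to [nat] by 0, so that [sum_simplices] applies. *)
have := sum_simplices (fun j => if insub j is Some j' then a j' else 0)
  (ltn_ord i).
rewrite valK => <-.
under eq_bigr do rewrite valK.
by rewrite a0 ffunE.
Qed.

Lemma dim_simplices S : \dim <<simplices S>> = #|S|.
Proof. by rewrite (eqnP (free_simplices S)) size_map cardE. Qed.

Lemma chainsE k : chains F X k = <<simplices [set s : {set X} | #|s| == k.+1]>>%VS.
Proof. by []. Qed.

(** Exchanging the two sums in the boundary collects, at each nonempty [t], the contributions of its
    cofacets [v |: t]. The pivot argument reads boundaries in this form. *)
Lemma boundary_coef c t : boundary F X c t =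
  if t == set0 then 0
  else \sum_(v | v \notin t) (-1) ^+ vertex_index (v |: t) v * c (v |: t).
Proof.
rewrite lfunE /= /boundary_fun sum_ffunE.
have -> : \sum_(s : {set X} | (1 < #|s|)%N)
    (c s *: \sum_(v in s) (-1) ^+ vertex_index s v *: simplex_chain F (s :\ v)) t
  = \sum_(s : {set X} | (1 < #|s|)%N) \sum_(v in s)
      (-1) ^+ vertex_index s v * c s * (t == s :\ v)%:R.
  apply: eq_bigr => s _; rewrite ffunE sum_ffunE scaler_sumr.
  apply: eq_bigr => v _; rewrite ffunE simplex_chainE.
  by rewrite /GRing.scale /= mulrCA mulrA.
rewrite (exchange_big_dep predT) //=.
have [->|/set0Pn[z zt]] := eqVneq t set0.
  rewrite big1 // => v _; rewrite big1 // => s /andP[lt1 vs].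
  case: eqP => [s0|_]; last by rewrite mulr0.
  by move: lt1; rewrite (cardsD1 v) vs -s0 cards0.
rewrite [RHS]big_mkcond /=; apply: eq_bigr => v _.
have [vt|vt] := boolP (v \in t); rewrite /=.
  rewrite big1 // => s /andP[_ vs]; case: eqP => [ts|_]; last by rewrite mulr0.
  by move: vt; rewrite ts !inE eqxx.
rewrite (bigD1 (v |: t)) /=; last first.
  by rewrite !inE eqxx cardsU1 vt /= andbT add1n ltnS (cardsD1 z) zt.
rewrite setU1K // eqxx mulr1 big1 ?addr0 // => s /andP[/andP[_ vs] ns].
case: eqP => [ts|_]; last by rewrite mulr0.
by move: ns; rewrite ts setD1K ?eqxx.
Qed.

Lemma boundary_coef_neq0 c t : boundary F X c t != 0 ->
  t != set0 /\ exists2 v, v \notin t & c (v |: t) != 0.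
Proof.
rewrite boundary_coef; have [_|_ nz] := eqVneq t set0; first by rewrite eqxx.
split=> //; apply/exists_inP; apply: contraNT nz => /exists_inPn c0.
rewrite big1 // => v vt; have /negPn/eqP -> := c0 v vt.
by rewrite mulr0.
Qed.

Lemma vertex_index_U1 s v w : w \notin s -> (enum_rank w < enum_rank v)%N ->
  vertex_index (w |: s) v = (vertex_index s v).+1.
Proof.
move=> ws lt_wv; rewrite /vertex_index.
have -> : [set z in w |: s | (enum_rank z < enum_rank v)%N] =
    w |: [set z in s | (enum_rank z < enum_rank v)%N].
  by apply/setP => z; rewrite !inE; case: eqP => [->|]; rewrite ?lt_wv.
by rewrite cardsU1 !inE (negPf ws).
Qed.

Lemma vertex_index_U1r s v w : (enum_rank v <= enum_rank w)%N ->
  vertex_index (w |: s) v = vertex_index s v.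
Proof.
move=> le_vw; congr #|pred_of_set _|; apply/setP => z; rewrite !inE.
by case: eqP => // ->; rewrite ltnNge le_vw /= andbF.
Qed.

(** Two vertices can be removed in either order. Removing the earlier one first shifts the index of
    the later one by one, so the two terms have opposite signs. *)
Lemma boundary_boundary c : boundary F X (boundary F X c) = 0.
Proof.
apply/ffunP => t; rewrite boundary_coef [RHS]ffunE.
case: eqP => // /eqP t0.
pose T v w := (-1) ^+ vertex_index (v |: t) v *
  ((-1) ^+ vertex_index (w |: (v |: t)) w * c (w |: (v |: t))).
pose lt (v w : X) := (enum_rank v < enum_rank w)%N.
have Tanti v w : v \notin t -> w \notin t -> lt v w -> T v w = - T w v.
  move=> vt wt lt_vw; rewrite /T.
  have vw : v != w by apply: contraTneq lt_vw => ->; rewrite /lt ltnn.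
  rewrite (vertex_index_U1r t (leqnn (enum_rank v))).
  rewrite (vertex_index_U1r (v |: t) (leqnn (enum_rank w))).
  rewrite (vertex_index_U1 vt lt_vw) (vertex_index_U1r t (leqnn (enum_rank w))).
  rewrite (vertex_index_U1r (w |: t) (leqnn (enum_rank v))).
  rewrite (vertex_index_U1r t (ltnW lt_vw)) (setUCA [set v]).
  by rewrite exprS mulN1r mulNr mulrN mulrCA.
have -> : \sum_(v | v \notin t) (-1) ^+ vertex_index (v |: t) v *
      boundary F X c (v |: t) =
    \sum_(v | v \notin t) (\sum_(w | (w \notin t) && lt v w) T v w
       + \sum_(w | (w \notin t) && lt w v) T v w).
  apply: eq_bigr => v vt; rewrite boundary_coef.
  have /negPf-> : v |: t != set0.
    by apply/set0Pn; exists v; rewrite !inE eqxx.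
  rewrite mulr_sumr (bigID (lt v)) /=; congr (_ + _); apply: eq_bigl => w;
    rewrite !inE negb_or /lt.
    case: (w \in t); rewrite ?andbF ?andbT //=.
    by case: eqP => // ->; rewrite ltnn.
  case: (w \in t); rewrite ?andbF ?andbT //= -leqNgt ltn_neqAle.
  by rewrite -(inj_eq enum_rank_inj) -val_eqE.
(* Swapping the sums in the second half puts each pair with [v] before [w] next to its mirror
   pair. *)
rewrite big_split /= [X in _ + X](exchange_big_dep (fun w => w \notin t)) /=;
  last by move=> ? ? _ /andP[].
rewrite -big_split big1 // => v vt /=.
under [X in _ + X]eq_bigl => w do rewrite vt /=.
rewrite -big_split big1 // => w /andP[wt lt_vw].
by rewrite /= (Tanti v w) // addNr.
Qed.

Lemma boundary_chains k c : c \in chains F X k.+1 ->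
  boundary F X c \in chains F X k.
Proof.
rewrite !chainsE => /mem_simplices ck; apply/mem_simplices => t.
case/boundary_coef_neq0 => _ [v vt /ck].
by rewrite !inE cardsU1 vt.
Qed.

Lemma boundaries_sub_cycles k : (boundaries F X k <= cycles F X k)%VS.
Proof.
apply/subvP => _ /memv_imgP[c ck ->].
by rewrite memv_cap boundary_chains // memv_ker boundary_boundary /=.
Qed.

End SimplexChains.

(** * Diameters of vertex sets *)

Section Diameter.
Variables (R : realType) (X : finType) (u : X -> X -> R).
Implicit Types (s t : {set X}).

(** The maxima defining [diam] start from 0, hence the condition on [e]. *)
Lemma diam_leP s (e : R) : 0 <= e ->
  reflect {in s &, forall p q, u p q <= e} (diam u s <= e).
Proof.
move=> e0; apply: (iffP (bigmax_leP _ _ _ _)) => [[_ le_e] p q ps qs|le_e].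
  by have /bigmax_leP[_] := le_e p ps; apply.
by split=> // p ps; apply/bigmax_leP; split=> // q qs; apply: le_e.
Qed.

Lemma diam_ge0 s : 0 <= diam u s.
Proof. exact: bigmax_ge_id. Qed.

Lemma le_diam s p q : p \in s -> q \in s -> u p q <= diam u s.
Proof. by move=> ps qs; apply: (elimT (diam_leP _ (diam_ge0 s))). Qed.

Lemma diam_subset s t : s \subset t -> diam u s <= diam u t.
Proof.
move=> /subsetP sub_st; apply/diam_leP => [|p q ps qs]; first exact: diam_ge0.
by apply: le_diam; apply: sub_st.
Qed.

End Diameter.

(** * The filtration and orthogonal families *)

Section Filtration.
Variables (F : fieldType) (R : realType) (X : finType) (u : X -> X -> R).
Implicit Types (c d : chain F X) (s t : {set X}) (S : {set {set X}}).
Local Notation ell := (filtration u).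

Lemma filtration_leP c e :
  reflect (forall s, c s != 0 -> ((diam u s)%:E <= e)%E) (ell c <= e)%E.
Proof.
by apply: (iffP (bigmax_leP _ _ _ _)) => [[]|] //; split; rewrite ?leNye.
Qed.

Lemma le_filtration c s : c s != 0 -> ((diam u s)%:E <= ell c)%E.
Proof. exact/filtration_leP. Qed.

Lemma filtration_gtNy c : c != 0 -> (-oo < ell c)%E.
Proof.
move=> nz; suff /existsP[s cs] : [exists s, c s != 0].
  exact: lt_le_trans (ltNyr _) (le_filtration cs).
apply: contraNT nz => /existsPn c0; apply/eqP/ffunP => s.
by rewrite [RHS]ffunE; apply/eqP/negPn/c0.
Qed.

Lemma filtration_simplex s : ell (simplex_chain F s) = (diam u s)%:E.
Proof.
apply/le_anti/andP; split; last first.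
  by apply: le_filtration; rewrite simplex_chainE eqxx oner_eq0.
apply/filtration_leP => t; rewrite simplex_chainE.
by have [->|_] := eqVneq t s; rewrite ?eqxx.
Qed.

Lemma filtrationZ a c : (ell (a *: c) <= ell c)%E.
Proof.
apply/filtration_leP => s; rewrite ffunE => nz; apply: le_filtration.
by apply: contraNneq nz => ->; rewrite scaler0.
Qed.

Lemma filtrationD c d e : (ell c <= e -> ell d <= e -> ell (c + d)%R <= e)%E.
Proof.
move=> /filtration_leP ce /filtration_leP de; apply/filtration_leP => s.
rewrite ffunE => nz; have [c0|/ce//] := eqVneq (c s) 0.
by apply: de; rewrite c0 add0r in nz.
Qed.

Lemma filtration_sum n (a : nat -> F) (c : seq (chain F X)) e :
  (forall i, (i < n)%N -> a i != 0%R -> (ell c`_i <= e)%E) ->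
  (ell (\sum_(i < n) a i *: c`_i)%R <= e)%E.
Proof.
move=> le_e; elim/big_ind: _ => [|d d'|i _]; last 2 first.
- exact: filtrationD.
- have [->|nz] := eqVneq (a i) 0; last exact: le_trans (filtrationZ _ _) (le_e _ _ _).
  by apply/filtration_leP => s; rewrite scale0r ffunE eqxx.
- by apply/filtration_leP => s; rewrite ffunE eqxx.
Qed.

(** The filtration of a combination never exceeds the maximum, so only the lower bound is left to
    state. Coefficients are indexed by [nat] so that sums can be split and shifted freely. *)
Lemma orthogonal_chainsP (c : seq (chain F X)) :
  orthogonal_chains u c <->
  forall (a : nat -> F) i, (i < size c)%N -> a i != 0 ->
    (ell c`_i <= ell (\sum_(j < size c) a j *: c`_j)%R)%E.
Proof.
split=> [orth a i lti ai|orth a].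
  rewrite (orth (fun j => a j)).
  exact: (@le_bigmax_cond _ _ _ _ (Ordinal lti)).
pose b j := if insub j is Some j' then a j' else 0.
have ba j : b (val j) = a j by rewrite /b valK.
under eq_bigr do rewrite -ba.
apply/le_anti/andP; split.
  apply: filtration_sum => i lti bi.
  apply: (@le_bigmax_cond _ _ _ _ (Ordinal lti)).
  by rewrite -ba.
by apply/bigmax_leP; split=> [|i]; rewrite ?leNye // -ba; apply/orth/ltn_ord.
Qed.

Lemma orthogonal_simplices S : orthogonal_chains u (simplices F S).
Proof.
apply/orthogonal_chainsP => a i lti ai.
rewrite (nth_map set0) ?filtration_simplex; last by rewrite -(size_map (@simplex_chain F X)).
by apply: le_filtration; rewrite sum_simplices.
Qed.

Lemma sum_memv_span n (a : nat -> F) (c : seq (chain F X)) : n = size c ->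
  \sum_(j < n) a j *: c`_j \in <<c>>%VS.
Proof.
move=> ->; apply: memv_suml => j _; apply/memvZ/memv_span/mem_nth.
exact: ltn_ord.
Qed.

Lemma orthogonal_map (f : 'End(chain F X)) (c : seq (chain F X)) :
  {in <<c>>%VS, forall d, ell (f d) = ell d} ->
  orthogonal_chains u c -> orthogonal_chains u (map f c).
Proof.
move=> fl /orthogonal_chainsP orth; apply/orthogonal_chainsP => a i.
rewrite size_map => lti ai; rewrite (nth_map 0) // fl; last first.
  by apply/memv_span/mem_nth.
have -> : \sum_(j < size c) a j *: (map f c)`_j =
    f (\sum_(j < size c) a j *: c`_j).
  by rewrite linear_sum; apply: eq_bigr => j _; rewrite (nth_map 0) // linearZ.
by rewrite fl ?sum_memv_span // orth.
Qed.

(** Bounding the second part is enough: the first is the total minus the second, so it obeys the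
    same bound. *)
Lemma orthogonal_cat (c d : seq (chain F X)) :
  orthogonal_chains u c -> orthogonal_chains u d ->
  (forall z1 z2, z1 \in <<c>>%VS -> z2 \in <<d>>%VS -> ell z2 <= ell (z1 + z2)%R)%E ->
  orthogonal_chains u (c ++ d).
Proof.
move=> /orthogonal_chainsP oc /orthogonal_chainsP od le_cd; apply/orthogonal_chainsP => a i.
rewrite size_cat => lti ai; rewrite big_split_ord /=.
under eq_bigr => j _ do rewrite nth_cat ltn_ord.
under [X in _ + X]eq_bigr => j _ do rewrite nth_cat ltnNge leq_addr /= addKn.
set z1 := \sum_(j < _) _; set z2 := \sum_(j < _) _.
have le2 : (ell z2 <= ell (z1 + z2)%R)%E.
  by apply: le_cd; [apply: sum_memv_span | apply: (sum_memv_span (fun j => a (_ + j)%N))].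
have le1 : (ell z1 <= ell (z1 + z2)%R)%E.
  rewrite -[X in (ell X <= _)%E](addrK z2) filtrationD //.
  by rewrite -scaleN1r; apply: le_trans le2; apply: filtrationZ.
rewrite nth_cat; case: ltnP => lei; first by apply: le_trans le1; apply: oc.
apply: le_trans le2; apply: (od (fun j => a (size c + j)%N)); last by rewrite subnKC.
by rewrite ltn_subLR.
Qed.

(** A vanishing combination has filtration [-oo], whereas any vector with a nonzero coefficient
    would force a larger value. *)
Lemma orthogonal_free (c : seq (chain F X)) :
  0 \notin c -> orthogonal_chains u c -> free c.
Proof.
move=> nz /orthogonal_chainsP oc; apply/(@freeP _ _ _ (in_tuple _)) => a a0 i.
pose b j := if insub j is Some j' then a j' else 0.
have ba j : b (val j) = a j by rewrite /b valK.
apply/eqP; apply: contraT; rewrite -ba => bi.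
have b0 : \sum_(j < size c) b j *: c`_j = 0.
  by rewrite -[RHS]a0; apply: eq_bigr => j _; rewrite ba.
have := oc b i (ltn_ord i) bi; rewrite b0.
rewrite leNgt => /negP[].
apply: le_lt_trans (_ : (-oo < _)%E); last first.
  by apply: filtration_gtNy; apply: contraNneq nz => <-; rewrite mem_nth.
by apply/filtration_leP => s; rewrite ffunE eqxx.
Qed.

(** By orthogonality, a vector that occurs in the expansion of [v] has filtration at most that of
    [v]. *)
Lemma orthogonal_span (c : seq (chain F X)) v :
  orthogonal_chains u c -> v \in <<c>>%VS ->
  v \in <<[seq d <- c | (ell d <= ell v)%E]>>%VS.
Proof.
move=> /orthogonal_chainsP oc /(@coord_span _ _ _ (in_tuple _)) def_v.
pose b j := if insub j is Some j' then coord (in_tuple c) j' v else 0.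
have ba j : b (val j) = coord (in_tuple c) j v by rewrite /b valK.
have {}def_v : v = \sum_(j < size c) b j *: c`_j.
  by rewrite {1}def_v; apply: eq_bigr => j _; rewrite ba.
rewrite {1}def_v; apply: memv_suml => j _.
have [->|bj] := eqVneq (b j) 0; first by rewrite scale0r mem0v.
apply/memvZ/memv_span; rewrite mem_filter mem_nth // andbT {1}def_v.
exact: oc.
Qed.

(** By [orthogonal_span], the vectors of [c] whose filtration lies in the down-set [P] are spanned
    by the vectors of [d] of the same kind. Both families are free, so dimensions compare their
    sizes, and the roles of [c] and [d] are symmetric. *)
Lemma count_orthogonal_basis (U : {vspace chain F X}) (P : pred (\bar R))
    (c d : seq (chain F X)) :
  (forall e e' : \bar R, (e <= e')%E -> P e' -> P e) ->
  basis_of U c -> orthogonal_chains u c -> basis_of U d -> orthogonal_chains u d ->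
  count P (map ell c) = count P (map ell d).
Proof.
move=> downP.
wlog suff le_cd : c d / basis_of U c -> orthogonal_chains u c ->
    basis_of U d -> orthogonal_chains u d ->
    (count P (map ell c) <= count P (map ell d))%N.
  by move=> bc oc bd od; apply/eqP; rewrite eqn_leq !le_cd.
move=> bc oc bd od; rewrite !count_map -!size_filter.
have/eqnP <- : free (filter (preim ell P) c) by rewrite filter_free ?(basis_free bc).
have/eqnP <- : free (filter (preim ell P) d) by rewrite filter_free ?(basis_free bd).
apply/dimvS/span_subvP => v; rewrite mem_filter => /andP[/= Pv cv].
have vd : v \in <<d>>%VS by rewrite (span_basis bd) (basis_mem bc).
apply: subvP (orthogonal_span od vd); apply/span_subvP => w.
rewrite mem_filter => /andP[le_wv dw]; apply/memv_span.
by rewrite mem_filter dw andbT /= (downP _ _ le_wv).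
Qed.

(** The multiplicity of [e] is the number of values at most [e] minus the number of values below
    [e], and both conditions are closed downwards. *)
Lemma perm_orthogonal_basis (U : {vspace chain F X}) (c d : seq (chain F X)) :
  basis_of U c -> orthogonal_chains u c -> basis_of U d -> orthogonal_chains u d ->
  perm_eq (map ell c) (map ell d).
Proof.
move=> bc oc bd od; apply/allP => e _ /=; apply/eqP.
have split_le (l : seq (\bar R)) : (count (fun x => (x <= e)%E) l =
    count_mem e l + count (fun x => (x < e)%E) l)%N.
  elim: l => //= x l ->; rewrite addnACA; congr (_ + _)%N.
  by rewrite le_eqVlt; case: eqP => //= ->; rewrite ltxx.
apply: (@addIn (count (fun x => (x < e)%E) (map ell c))).
rewrite -split_le [in RHS](count_orthogonal_basis _ bc oc bd od).
  rewrite -split_le; apply: count_orthogonal_basis bc oc bd od => ? ?.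
  exact: le_trans.
by move=> ? ?; apply: le_lt_trans.
Qed.

Lemma filtration_boundary c : (ell (boundary F X c) <= ell c)%E.
Proof.
apply/filtration_leP => t /boundary_coef_neq0[_ [v vt cv]].
by apply: le_trans (le_filtration cv); rewrite lee_fin diam_subset ?subsetU1.
Qed.

End Filtration.

(** * Barcodes all of whose bars have length zero *)

Section EphemeralBarcode.
Variables (F : fieldType) (R : realType) (X : finType) (u : X -> X -> R).
Local Notation ell := (filtration u).

(** Fill [w_i] by a chain [v] of no larger filtration. The expansion of [v] in the basis [y] must
    involve [y_i], so orthogonality bounds the filtration of [y_i] by that of [w_i]; the other
    inequality holds because the boundary never raises the filtration. *)
Lemma bars_ephemeral k (y w : seq (chain F X)) :
  cycles F X k = boundaries F X k ->
  {in cycles F X k, forall z, exists2 v, v \in chains F X k.+1 &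
    boundary F X v = z /\ (ell v <= ell z)%E} ->
  singular_bases u k y w -> bars u k y w = [seq (e, e) | e <- map ell w].
Proof.
move=> cyclesE fill [[basis_y orth_y] [basis_w _] basis_drop _ bd_y].
(* Since every cycle is a boundary, [w] has exactly as many entries as the rank, and no bar is
   infinite. *)
have size_w : size w = \dim (boundaries F X k).
  by rewrite -cyclesE (@size_basis _ _ _ _ (in_tuple w)).
rewrite -[in RHS](mkseq_nth 0 w) /mkseq /bars -!map_comp.
apply/eq_in_map => i; rewrite mem_iota /= add0n size_w => lti.
rewrite lti /=; congr (_, _); set r := \dim _ in lti size_w basis_drop bd_y *.
have szr j : (j < r)%N -> (j < size w)%N by rewrite size_w.
have lt_iy : (i < size y)%N.
  rewrite -(@size_basis _ _ _ _ (in_tuple y) basis_y); apply: leq_trans lti _.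
  by rewrite -(limg_ker_dim (boundary F X) (chains F X k.+1)) leq_addl.
apply/le_anti/andP; split; last by rewrite -bd_y // filtration_boundary.
have cyc_w : w`_i \in cycles F X k by rewrite (basis_mem basis_w) ?mem_nth ?szr.
have [v vC [bd_v le_v]] := fill _ cyc_w; apply: le_trans le_v.
have def_v := @coord_basis _ _ _ _ (in_tuple y) v basis_y vC.
pose b j := if insub j is Some j' then coord (in_tuple y) j' v else 0.
have ba j : b (val j) = coord (in_tuple y) j v by rewrite /b valK.
have {}def_v : v = \sum_(j < size y) b j *: y`_j.
  by rewrite {1}def_v; apply: eq_bigr => j _; rewrite ba.
rewrite {1}def_v; move/orthogonal_chainsP: orth_y; apply=> //.
(* If [y_i] did not occur in [v], the coordinate of [w_i] along itself in the basis [w] would be 0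
   instead of 1. *)
apply: contraTneq (oner_neq0 F) => bi.
have lt_iw := szr i lti.
have := @coord_free _ _ _ (in_tuple w) (Ordinal lt_iw) (Ordinal lt_iw)
  (basis_free basis_w).
rewrite eqxx mulr1n /= -bd_v {1}def_v linear_sum linear_sum big1 => [/esym->|j _].
  by rewrite eqxx.
(* For [j < r] the boundary of [y_j] is [w_j], which contributes to coordinate [i] only when
   [j = i]; from [r] on, [y_j] is a cycle. *)
rewrite linearZ linearZ /=; have [ltj|gej] := ltnP j r.
  rewrite bd_y // (@coord_free _ _ _ (in_tuple w) (Ordinal (szr j ltj)))
    ?(basis_free basis_w) //.
  by rewrite -val_eqE /=; case: eqP => [->|]; rewrite ?bi ?mul0r ?mulr0.
have /(basis_mem basis_drop) : y`_j \in drop r y.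
  by rewrite -(subnKC gej) -nth_drop mem_nth // size_drop ltn_sub2r // (leq_ltn_trans gej).
by rewrite memv_cap memv_ker => /andP[_ /eqP->]; rewrite linear0 mulr0.
Qed.

End EphemeralBarcode.

(** * Positions of points and first vertices *)

Section SelfConsistentOrder.
Variables (R : realType) (X : finType) (u : X -> X -> R).
Variables (n : nat) (x : nat -> X).
Hypotheses (hu : is_ultrametric u) (hx : self_consistent u n x).
Implicit Types (s t : {set X}) (v w : X).

Let xs := [seq x i | i <- iota 1 n].

Definition position v := (index v xs).+1.

(** Positions count from 1, like the labels of [x]; the empty set gets [n.+1]. *)
Definition first_position s := (find [in s] xs).+1.

Let size_xs : size xs = n. Proof. by rewrite size_map size_iota. Qed.

Let nth_xs v i : (i < n)%N -> nth v xs i = x i.+1.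
Proof. by move=> lti; rewrite (nth_map 0) ?size_iota // nth_iota ?add1n. Qed.

Let mem_xs v : v \in xs.
Proof. by rewrite (perm_mem hx.1) mem_enum. Qed.

Let uniq_xs : uniq xs.
Proof. by rewrite (perm_uniq hx.1) enum_uniq. Qed.

Lemma position_le v : (0 < position v <= n)%N.
Proof. by rewrite /position -size_xs index_mem mem_xs. Qed.

Lemma positionK v : x (position v) = v.
Proof.
by rewrite -(nth_xs v) ?nth_index // -size_xs index_mem.
Qed.

Lemma nthK i : (0 < i <= n)%N -> position (x i) = i.
Proof.
case: i => // i /= lti; rewrite /position -(nth_xs (x 0)) //.
by rewrite index_uniq // size_xs.
Qed.

Lemma first_le s v : v \in s -> (first_position s <= position v)%N.
Proof.
move=> vs; rewrite ltnS leqNgt; apply/negP => /(before_find v).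
by rewrite nth_index //= vs.
Qed.

Lemma first_mem s : s != set0 -> x (first_position s) \in s.
Proof.
case/set0Pn => v vs; have has_s : has [in s] xs by apply/hasP; exists v.
by rewrite -(nth_xs v) -?size_xs -?has_find //; apply: nth_find.
Qed.

Lemma first_range s : s != set0 -> (0 < first_position s <= n)%N.
Proof.
case/set0Pn => v vs; have /andP[_] := position_le v.
exact: leq_trans (first_le vs).
Qed.

Lemma first_eq s i : (0 < i <= n)%N -> x i \in s ->
  {in s, forall v, i <= position v}%N -> first_position s = i.
Proof.
move=> lei xis min_i; have s0 : s != set0 by apply/set0Pn; exists (x i).
apply/eqP; rewrite eqn_leq -{1}(nthK lei) first_le //.
by have := min_i _ (first_mem s0); rewrite nthK // first_range.
Qed.

Lemma first_lt s : (1 < #|s|)%N -> (first_position s < n)%N.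
Proof.
move=> lt1; have s0 : s != set0 by rewrite -card_gt0 ltnW.
have /card_gt0P[v] : (0 < #|s :\ x (first_position s)|)%N.
  by move: lt1; rewrite (cardsD1 (x (first_position s))) first_mem.
rewrite !inE => /andP[nv vs]; have /andP[_] := position_le v.
apply: leq_trans; rewrite ltn_neqAle first_le // andbT.
by apply: contraNneq nv => ->; rewrite positionK.
Qed.

(** * The matching between up simplices and the others *)

Definition up s := (first_position s < n)%N && (x (first_position s).+1 \in s).
(** [pop] and [push] are the two directions of the matching: [pop] leads from an up simplex to a
    facet that is not up, and undoes [push] on simplices that are not up and have at least two
    vertices. *)
Definition pop s := s :\ x (first_position s).+1.
Definition push s := x (first_position s).+1 |: s.

Lemma up_neq0 s : up s -> s != set0.
Proof. by case/andP=> _ xs'; apply/set0Pn; exists (x (first_position s).+1). Qed.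

Lemma position_succ s : (first_position s < n)%N ->
  position (x (first_position s).+1) = (first_position s).+1.
Proof. by move=> lt_sn; apply: nthK. Qed.

Lemma first_mem_pop s : up s -> x (first_position s) \in pop s.
Proof.
move=> us; have s0 := up_neq0 us; rewrite !inE first_mem // andbT.
apply/eqP => /(congr1 position); rewrite nthK ?first_range //.
by rewrite position_succ ?(andP us).1 // => /eqP; rewrite eqn_leq ltnn andbF.
Qed.

Lemma first_pop s : up s -> first_position (pop s) = first_position s.
Proof.
move=> us; apply: first_eq (first_mem_pop us) _.
  exact/first_range/up_neq0.
by move=> v; rewrite inE => /andP[_ vs]; apply: first_le.
Qed.

Lemma first_push s : s != set0 -> (first_position s < n)%N ->
  first_position (push s) = first_position s.
Proof.
move=> s0 ltn; apply: first_eq (first_range s0) _ _.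
  by rewrite !inE first_mem ?orbT.
by move=> v /setU1P[->|/first_le//]; rewrite position_succ.
Qed.

Lemma up_push s : (1 < #|s|)%N -> up (push s).
Proof.
move=> lt1; have s0 : s != set0 by rewrite -card_gt0 ltnW.
by rewrite /up first_push ?first_lt // !inE eqxx.
Qed.

Lemma card_push s : (1 < #|s|)%N -> ~~ up s -> #|push s| = #|s|.+1.
Proof.
by move=> lt1; rewrite /up first_lt //= => nus; rewrite cardsU1 nus.
Qed.

Lemma pushK s : (1 < #|s|)%N -> ~~ up s -> pop (push s) = s.
Proof.
move=> lt1; have s0 : s != set0 by rewrite -card_gt0 ltnW.
by rewrite /pop first_push ?first_lt // /up first_lt //= => /setU1K.
Qed.

Lemma card_pop s : up s -> #|s| = #|pop s|.+1.
Proof. by case/andP=> _ us; rewrite (cardsD1 (x (first_position s).+1)) us. Qed.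

Lemma pop_not_up s : up s -> ~~ up (pop s).
Proof. by move=> us; rewrite /up first_pop // !inE eqxx andbF. Qed.

(** If [v] does not precede the first vertex, that vertex stays first; its successor, absent from
    [pop s], can then only be [v]. The strict drop of the first position otherwise is what makes the
    matching acyclic. *)
Lemma up_cofacet s v : up s -> up (v |: pop s) ->
  v \notin pop s ->
  v = x (first_position s).+1 \/ (first_position (v |: pop s) < first_position s)%N.
Proof.
move=> us uv vs; have [lt_vs|le_sv] := ltnP (position v) (first_position s).
  by right; apply: leq_ltn_trans lt_vs; apply: first_le; rewrite !inE eqxx.
left; have fE : first_position (v |: pop s) = first_position s.
  apply: first_eq; first exact/first_range/up_neq0.
    by rewrite inE first_mem_pop ?orbT.
  by move=> w /setU1P[->//|]; rewrite inE => /andP[_ /first_le].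
case/andP: uv => _; rewrite fE => /setU1P[//|].
by rewrite !inE eqxx.
Qed.

(** * Distances along the order *)

Lemma u_ge0 v w : 0 <= u v w.
Proof. by case: hu => -[]. Qed.

Lemma u_sym v w : u v w = u w v.
Proof. by case: hu => -[]. Qed.

Lemma u_refl v : u v v = 0.
Proof. by case: hu => -[_ u0 _ _] _; apply/u0. Qed.

Lemma u_max v w z : u v z <= Num.max (u v w) (u w z).
Proof. by case: hu. Qed.

Lemma u_succ_le i j : (0 < i < j)%N -> (j <= n)%N -> u (x i) (x i.+1) <= u (x i) (x j).
Proof.
case/andP=> i0 ltij lejn; apply: (hx.2 i.+1).
  by rewrite ltnS i0 (leq_trans ltij).
apply/mapP => -[m]; rewrite mem_iota => /andP[m0 ltm] /(congr1 position).
rewrite !nthK ?m0 ?(leq_trans i0 (ltnW ltij)) //; last first.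
  by rewrite (leq_trans _ (leq_trans ltij lejn)) // ltnW.
by move=> ejm; rewrite -ejm add1n ltnS leqNgt ltij in ltm.
Qed.

(** Pass through [x i]: its distance to the successor is at most its distance to [x j]. *)
Lemma u_succ_left i j : (0 < i < j)%N -> (j <= n)%N -> u (x i.+1) (x j) <= u (x i) (x j).
Proof.
move=> lt_ij lejn; apply: le_trans (u_max _ (x i) _) _.
by rewrite ge_max lexx andbT u_sym u_succ_le.
Qed.

(** Shrinking an interval of labels does not increase the distance between its ends. The left end is
    moved first, one successor at a time, then the right end. *)
Lemma u_mono i a b j : (0 < i <= a)%N -> (a <= b <= j)%N -> (j <= n)%N ->
  u (x a) (x b) <= u (x i) (x j).
Proof.
move=> /andP[i0 leia] /andP[leab lebj] lejn.
have mono_left d m : (0 < m)%N -> (m + d <= j)%N -> u (x (m + d)%N) (x j) <= u (x m) (x j).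
  elim: d => [|d IHd] m0; first by rewrite addn0.
  rewrite addnS => ltj; apply: le_trans (IHd m0 (ltnW ltj)).
  by apply: u_succ_left => //; rewrite ltj addn_gt0 m0.
(* Moving the left end from [i] to [a] reduces the claim to intervals starting at [a]. *)
apply: le_trans (_ : u (x a) (x j) <= _); last first.
  by rewrite -(subnKC leia) mono_left // subnKC // (leq_trans leab).
rewrite -(subnKC leab); have : (a + (b - a) <= j)%N by rewrite subnKC.
have : (0 < a)%N by rewrite (leq_trans i0).
move: (b - a)%N => d {leia leab lebj}.
(* The left end stays general in the induction: the ultrametric inequality passes through [x a.+1],
   and the remaining gap is shorter by one. *)
elim: d a => [|d IHd] a a0; first by rewrite addn0 u_refl u_ge0.
rewrite -addSnnS => leaj; have ltaj : (a < j)%N by rewrite (leq_trans _ leaj) // leq_addr.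
apply: le_trans (u_max _ (x a.+1) _) _; rewrite ge_max u_succ_le ?a0 //=.
by apply: le_trans (IHd _ _ _) _; rewrite // u_succ_left // a0.
Qed.

(** With three vertices, [pop s] keeps some [z] after the first vertex [a], and the successor [b] is
    no farther from [a] than [z] is. Any distance from [b] is then controlled by passing through
    [a]. *)
Lemma diam_pop s : up s -> (2 < #|s|)%N -> diam u (pop s) = diam u s.
Proof.
move=> us lt2; apply/le_anti; rewrite diam_subset ?subD1set //=.
have xf := first_mem_pop us; set a := x (first_position s) in xf.
set b := x (first_position s).+1.
have [ltf bs] := andP us; have s0 := up_neq0 us.
have near_b q : q \in s -> u b q <= diam u (pop s).
  have le_ab : u a b <= diam u (pop s).
    have /card_gt0P[z] : (0 < #|pop s :\ a|)%N.
      by move: lt2; rewrite (card_pop us) (cardsD1 a) xf.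
    rewrite in_setD1 => /andP[za zp]; apply: le_trans (le_diam _ xf zp).
    rewrite -(positionK z); apply: u_succ_le; last by case/andP: (position_le z).
    have /andP[-> _] := first_range s0; rewrite ltn_neqAle first_le; last first.
      by move: zp; rewrite inE => /andP[].
    by rewrite andbT; apply: contraNneq za => e; rewrite /a e positionK.
  move=> qs; have [->|nqb] := eqVneq q b; first by rewrite u_refl diam_ge0.
  apply: le_trans (u_max _ a _) _; rewrite ge_max u_sym le_ab /=.
  by apply: le_diam xf _; rewrite !inE nqb.
apply/diam_leP => [|p q ps qs]; first exact: diam_ge0.
have [->|npb] := eqVneq p b; first exact: near_b.
have [->|nqb] := eqVneq q b; first by rewrite u_sym near_b.
by apply: le_diam; rewrite !inE ?npb ?nqb.
Qed.

End SelfConsistentOrder.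

(** * Orthogonal bases built from up simplices *)

Section UpBases.
Variables (F : fieldType) (R : realType) (X : finType) (u : X -> X -> R).
Variables (n : nat) (x : nat -> X).
Hypotheses (hu : is_ultrametric u) (hx : self_consistent u n x).
Implicit Types (s t : {set X}) (v w : X) (c : chain F X).
Local Notation ell := (filtration u).
Local Notation up := (up n x).
Local Notation first_position := (first_position n x).
Local Notation pop := (pop n x).
Local Notation push := (push n x).

Definition up_simplices k : {set {set X}} := [set s | up s & #|s| == k.+1].

Definition up_boundaries k : seq (chain F X) :=
  map (boundary F X) (simplices F (up_simplices k.+1)).

(* Among the simplices of c satisfying K take t with the earliest first vertex;
   by up_cofacet no other simplex of c has pop t as a facet. *)
Lemma up_pivot k (K : pred {set X}) c s :
    c \in <<simplices F (up_simplices k.+1)>>%VS ->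
    (forall t v, up t -> #|t| = k.+2 -> K t -> K (v |: pop t)) ->
    c s != 0 -> K s ->
  exists2 t, K t /\ boundary F X c (pop t) != 0 & up t /\ #|t| = k.+2.
Proof.
move=> /mem_simplices upc facetK cs Ks.
case: (@arg_minnP _ s (fun t => (c t != 0) && K t) (fun t => first_position t)).
  by rewrite cs.
move=> t /andP[ct Kt] min_t; have := upc t ct.
rewrite inE => /andP[ut /eqP card_t]; exists t => //; split=> //.
have pop_n0 : pop t != set0.
  by rewrite -card_gt0 -ltnS -(card_pop ut) card_t.
have [_ xt] := andP ut.
rewrite boundary_coef (negPf pop_n0) (bigD1 (x (first_position t).+1)) /=; last first.
  by rewrite !inE eqxx.
rewrite setD1K // big1 => [|v /andP[vt nv]].
  by rewrite addr0 mulf_neq0 // signr_eq0.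
have [->|cv] := eqVneq (c (v |: pop t)) 0; first by rewrite mulr0.
have := upc _ cv; rewrite inE => /andP[uv _].
have [ev|] := up_cofacet hx ut uv vt; first by rewrite ev eqxx in nv.
by rewrite ltnNge min_t // cv facetK.
Qed.

(** The pivot with the trivial condition [predT] finds a nonzero boundary coefficient as soon as [c]
    is nonzero. *)
Lemma up_boundary_eq0 k c : c \in <<simplices F (up_simplices k.+1)>>%VS ->
  boundary F X c = 0 -> c = 0.
Proof.
move=> upc bd0; apply/ffunP => s; rewrite [RHS]ffunE; apply/eqP/negPn/negP => cs.
have [//|t [_]] := up_pivot (K := predT) upc _ cs isT.
by rewrite bd0 ffunE eqxx.
Qed.

(** Pivot on the simplices of diameter at least that of [s]; passing to [v |: pop t] keeps this
    condition because [pop] preserves the diameter, for which [0 < k] provides enough vertices. The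
    pivot [pop t] is not up, so [z] cannot cancel its coefficient. *)
Lemma le_up_boundary k z c : (0 < k)%N ->
  z \in <<simplices F (up_simplices k)>>%VS ->
  c \in <<simplices F (up_simplices k.+1)>>%VS ->
  (ell c <= ell (z + boundary F X c)%R)%E.
Proof.
move=> k0 /mem_simplices upz upc; apply/filtration_leP => s cs.
have [t v ut card_t|t [Kt bt] [ut card_t]] :=
    up_pivot (K := [pred t | diam u s <= diam u t]) upc _ cs (lexx _).
  rewrite !inE => le_st; apply: le_trans le_st _.
  by rewrite -(diam_pop hu hx ut) ?card_t // diam_subset ?subsetU1.
apply: le_trans (_ : ((diam u (pop t))%:E <= _)%E).
  by rewrite lee_fin (diam_pop hu hx) ?card_t.
apply: le_filtration; rewrite ffunE.
have [->|zt] := eqVneq (z (pop t)) 0; first by rewrite add0r.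
by have := upz _ zt; rewrite inE (negPf (pop_not_up hx ut)).
Qed.

Lemma filtration_up_boundary k c : (0 < k)%N ->
  c \in <<simplices F (up_simplices k.+1)>>%VS -> ell (boundary F X c) = ell c.
Proof.
move=> k0 upc; apply/le_anti; rewrite filtration_boundary /=.
by rewrite -[boundary F X c]add0r; apply: le_up_boundary upc; rewrite ?mem0v.
Qed.

Lemma up_boundariesE k :
  <<up_boundaries k>>%VS = (boundary F X @: <<simplices F (up_simplices k.+1)>>)%VS.
Proof. by rewrite limg_span. Qed.

Lemma up_boundary_lker k :
  (<<simplices F (up_simplices k.+1)>> :&: lker (boundary F X) = 0)%VS.
Proof.
apply/eqP; rewrite -subv0; apply/subvP => c; rewrite memv_cap memv_ker memv0.
by case/andP=> upc /eqP bd0; rewrite (up_boundary_eq0 upc bd0).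
Qed.

Lemma free_up_boundaries k : free (up_boundaries k).
Proof.
have basis_up : basis_of <<simplices F (up_simplices k.+1)>>%VS
    (simplices F (up_simplices k.+1)).
  by rewrite basisEfree free_simplices subvv dim_span.
exact: basis_free (limg_basis_of (up_boundary_lker k) basis_up).
Qed.

Lemma up_simplices_chains k :
  (<<simplices F (up_simplices k)>> <= chains F X k)%VS.
Proof.
rewrite chainsE; apply/subvP => c /mem_simplices upc; apply/mem_simplices => s /upc.
by rewrite !inE => /andP[].
Qed.

Lemma up_boundaries_sub k : (<<up_boundaries k>> <= boundaries F X k)%VS.
Proof. by rewrite up_boundariesE limgS // up_simplices_chains. Qed.

(** The [k]-simplices that are not up inject by [push] into the up simplices one dimension higher;
    [0 < k] excludes the unmatched last point. *)
Lemma dim_chains_le k : (0 < k)%N ->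
  (\dim (chains F X k) <= #|up_simplices k| + #|up_simplices k.+1|)%N.
Proof.
move=> k0; rewrite chainsE dim_simplices -(cardsID [set s | up s]) leq_add //.
  by rewrite subset_leq_card //; apply/subsetP => s; rewrite !inE andbC.
set N := _ :\: _; have N_P s : s \in N -> (1 < #|s|)%N /\ ~~ up s /\ #|s| = k.+1.
  by rewrite !inE => /andP[nus /eqP->].
rewrite -(card_in_imset (f := push) (D := N)) => [|s t /N_P[s1 [us _]] /N_P[t1 [ut _]] e].
  apply/subset_leq_card/subsetP => _ /imsetP[s /N_P[s1 [us cs]] ->].
  by rewrite inE (up_push hx) // (card_push hx) // cs eqxx.
by rewrite -(pushK hx s1 us) e (pushK hx).
Qed.

(** The cycles meet the span of the up [k]-simplices trivially, so the two dimensions add up to at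
    most that of all [k]-chains. *)
Lemma dim_cycles_le k : (0 < k)%N -> (\dim (cycles F X k) <= #|up_simplices k.+1|)%N.
Proof.
move=> k0; have [k' def_k] : exists k', k = k'.+1 by exists k.-1; rewrite prednK.
rewrite -(leq_add2l #|up_simplices k|); apply: leq_trans (dim_chains_le k0).
rewrite -(dim_simplices F) -dimv_disjoint_sum.
  by apply: dimvS; rewrite subv_add up_simplices_chains capvSl.
apply/eqP; rewrite -subv0 def_k -(up_boundary_lker k').
by rewrite capvS ?subvv // capvSr.
Qed.

Lemma size_up_boundaries k : size (up_boundaries k) = #|up_simplices k.+1|.
Proof. by rewrite !size_map cardE. Qed.

(** A free family of cycles whose size reaches the dimension bound is a basis. *)
Lemma basis_up_boundaries k : (0 < k)%N ->
  basis_of (cycles F X k) (up_boundaries k).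
Proof.
move=> k0; rewrite basisEfree free_up_boundaries size_up_boundaries dim_cycles_le //.
by rewrite (subv_trans (up_boundaries_sub k)) // boundaries_sub_cycles.
Qed.

Lemma cycles_boundaries k : (0 < k)%N -> cycles F X k = boundaries F X k.
Proof.
move=> k0; apply/eqP; rewrite eqEsubv boundaries_sub_cycles andbT.
by rewrite -(span_basis (basis_up_boundaries k0)) up_boundaries_sub.
Qed.

Lemma orthogonal_up_boundaries k : (0 < k)%N ->
  orthogonal_chains u (up_boundaries k).
Proof.
move=> k0; apply: orthogonal_map; last exact: orthogonal_simplices.
by move=> c upc; apply: filtration_up_boundary upc.
Qed.

Lemma up_filling k : (0 < k)%N ->
  {in cycles F X k, forall z, exists2 v, v \in chains F X k.+1 &
    boundary F X v = z /\ (ell v <= ell z)%E}.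
Proof.
move=> k0 z; rewrite -(span_basis (basis_up_boundaries k0)) up_boundariesE.
case/memv_imgP => v upv ->; exists v; first exact: subvP (up_simplices_chains _) _ upv.
by split=> //; rewrite (filtration_up_boundary k0 upv).
Qed.

(** This exhibits an admissible choice of bases, which shows that a barcode exists. The second half
    of the basis of chains is the basis of cycles from the next degree. *)
Lemma singular_bases_up k : (0 < k)%N ->
  singular_bases u k (simplices F (up_simplices k.+1) ++ up_boundaries k.+1)
    (up_boundaries k).
Proof.
move=> k0; set Y := _ ++ _.
have size_r : \dim (boundaries F X k) = size (simplices F (up_simplices k.+1)).
  rewrite -cycles_boundaries // (size_basis (X := in_tuple _) (basis_up_boundaries k0)).
  by rewrite size_map.
have orthY : orthogonal_chains u Y.
  apply: orthogonal_cat; first exact: orthogonal_simplices.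
    exact: orthogonal_up_boundaries.
  move=> z1 z2 upz; rewrite up_boundariesE => /memv_imgP[c upc ->].
  by rewrite (filtration_up_boundary _ upc) //; apply: le_up_boundary upz upc.
have nzY : 0 \notin Y.
  rewrite mem_cat negb_or.
  have := free_simplices F (up_simplices k.+1); rewrite free_directv => /andP[-> _].
  by have := free_up_boundaries k.+1; rewrite free_directv => /andP[-> _].
split; rewrite ?size_r ?drop_size_cat ?basis_up_boundaries //.
(* Orthogonality and the absence of 0 give freeness; [dim_chains_le] says that the family is large
   enough to be a basis. *)
- split=> //; rewrite basisEfree (orthogonal_free nzY orthY) span_cat subv_add.
  rewrite up_simplices_chains size_cat size_up_boundaries size_map -cardE.
  rewrite dim_chains_le // andbT (subv_trans (up_boundaries_sub _)) //.
  by rewrite (subv_trans (boundaries_sub_cycles _ _ _)) // capvSl.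
- by split=> //; apply: orthogonal_up_boundaries.
- rewrite take_oversize ?size_map // -cycles_boundaries //.
  exact: basis_up_boundaries.
- by move=> i lti; rewrite nth_cat lti (nth_map 0).
Qed.

Lemma bars_up_boundaries k : (0 < k)%N ->
  [seq (e, e) | e <- map ell (up_boundaries k)] =
  [seq ephemeral_bar (diam u s) | s <- enum (up_simplices k.+1)].
Proof.
move=> k0; rewrite -!map_comp; apply/eq_in_map => s; rewrite mem_enum => us /=.
rewrite (@filtration_up_boundary k) ?filtration_simplex //.
by apply/memv_span/map_f; rewrite mem_enum.
Qed.

(** For any admissible bases the bars are read off from [w], and two orthogonal bases of the cycles
    have the same multiset of filtration values. This includes the independence of the choices. *)
Lemma verbose_barcode_up k (B : seq (\bar R * \bar R)) : (0 < k)%N ->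
  is_verbose_barcode F u k B <->
  perm_eq B [seq ephemeral_bar (diam u s) | s <- enum (up_simplices k.+1)].
Proof.
move=> k0; rewrite -bars_up_boundaries //; split.
  move=> [y [w [yw /perm_trans]]]; apply.
  rewrite (bars_ephemeral (cycles_boundaries k0) (up_filling k0) yw).
  have [_ [bw ow] _ _ _] := yw; apply: perm_map.
  exact: perm_orthogonal_basis bw ow (basis_up_boundaries k0) (orthogonal_up_boundaries k0).
move=> permB; exists (simplices F (up_simplices k.+1) ++ up_boundaries k.+1).
have sing := singular_bases_up k0; exists (up_boundaries k); split=> //.
by rewrite (bars_ephemeral (cycles_boundaries k0) (up_filling k0) sing).
Qed.

End UpBases.

(** * Grouping a multiset by a key, and bounds for sorted tuples *)

Lemma perm_fibers (S I T : eqType) (key : S -> I) (h : I -> T) (E : seq S)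
    (L : seq I) : uniq L -> {in E, forall s, key s \in L} ->
  perm_eq [seq h (key s) | s <- E]
    (flatten [seq nseq (count (fun s => key s == p) E) (h p) | p <- L]).
Proof.
move=> uniqL keyL; rewrite -[X in perm_eq (map _ X)](_ : [seq s <- E | key s \in L] = E).
  elim: L uniqL {keyL} => [_|p L IHL /= /andP[pL uniqL]].
    by rewrite (eq_filter (a2 := pred0)) // filter_pred0.
  have /permPl := perm_filterC (fun s => key s == p) [seq s <- E | key s \in p :: L].
  rewrite perm_sym => perm_pL.
  apply: (perm_trans (perm_map (fun s => h (key s)) perm_pL)).
  rewrite map_cat -!filter_predI perm_cat //.
    rewrite (eq_filter (a2 := fun s => key s == p)); last first.
      by move=> s /=; rewrite in_cons; case: eqP.
    by elim: E {IHL perm_pL} => //= s E IHE; case: eqP => //= ->; rewrite perm_cons.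
  rewrite (eq_filter (a2 := fun s => key s \in L)) ?IHL // => s /=.
  by rewrite in_cons; case: eqP => //= ->; rewrite (negPf pL).
by apply/all_filterP/allP.
Qed.

Lemma eq_perm (T : eqType) (s t : seq T) : s = t -> perm_eq s t.
Proof. by move=> ->. Qed.

Lemma count_enum (T : finType) (A : {set T}) (P : pred T) :
  count P (enum A) = #|[set s in A | P s]|.
Proof.
rewrite -size_filter cardE; apply/perm_size/uniq_perm => [||s].
- by rewrite filter_uniq ?enum_uniq.
- exact: enum_uniq.
- by rewrite mem_filter !mem_enum inE andbC.
Qed.

Lemma sorted_tuple_bounds m N (t : m.+1.-tuple 'I_N) (i : 'I_N) :
  sorted ltn [seq val j | j <- t] -> i \in t ->
  (tnth t ord0 <= i <= tnth t ord_max)%N.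
Proof.
move=> sorted_t /tnthP[j ->]; set l := map _ _ in sorted_t.
have sorted_l : sorted leq l by apply: sub_sorted sorted_t; apply: ltnW.
have size_l : size l = m.+1 by rewrite size_map size_tuple.
have l_nth (a : 'I_m.+1) : val (tnth t a) = nth 0%N l a.
  by rewrite (tnth_nth (tnth t a)) (nth_map (tnth t a)) // size_tuple.
have mono (a b : 'I_m.+1) : (a <= b)%N -> (tnth t a <= tnth t b)%N.
  move=> leab; rewrite [X in (X <= _)%N]l_nth [X in (_ <= X)%N]l_nth.
  by apply: (sorted_leq_nth leq_trans leqnn); rewrite ?inE ?size_l.
by rewrite !mono // -ltnS.
Qed.

(** * Up simplices counted by first and last vertex *)

Section UpSimplexCount.
Variables (R : realType) (X : finType) (u : X -> X -> R).
Variables (n : nat) (x : nat -> X).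
Hypotheses (hu : is_ultrametric u) (hx : self_consistent u n x).
Implicit Types (s : {set X}) (v : X).
Local Notation position := (position n x).
Local Notation up := (up n x).
Local Notation first_position := (first_position n x).
Local Notation up_simplices := (up_simplices n x).

Definition last_position s := \max_(v in s) position v.

Lemma last_ge s v : v \in s -> (position v <= last_position s)%N.
Proof. exact: leq_bigmax_cond. Qed.

Lemma last_eq s j : (0 < j <= n)%N -> x j \in s ->
  {in s, forall v, position v <= j}%N -> last_position s = j.
Proof.
move=> lej xs max_j; apply/eqP; rewrite eqn_leq; apply/andP; split.
  by apply/bigmax_leqP.
by rewrite -{1}(nthK hx lej) last_ge.
Qed.

Lemma last_mem s : s != set0 -> x (last_position s) \in s.
Proof.
rewrite -card_gt0 /last_position => /(eq_bigmax_cond position)[v vs ->].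
by rewrite (positionK hx).
Qed.

Lemma last_le s : (last_position s <= n)%N.
Proof. by apply/bigmax_leqP => v _; case/andP: (position_le hx v). Qed.

Lemma position_inj : injective position.
Proof. exact: can_inj (positionK hx). Qed.

(** All vertices lie between the first and the last, so [u_mono] bounds every distance. *)
Lemma diam_first_last s : s != set0 ->
  diam u s = u (x (first_position s)) (x (last_position s)).
Proof.
move=> s0; apply/le_anti/andP; split; last first.
  by apply: le_diam; rewrite ?(first_mem hx) ?last_mem.
have u0 := u_ge0 hu; apply/diam_leP => // p q ps qs.
wlog le_pq : p q ps qs / (position p <= position q)%N => [IH|].
  have [le|/ltnW le] := leqP (position p) (position q); first exact: IH.
  by rewrite (u_sym hu); apply: IH.
rewrite -{1}(positionK hx p) -{1}(positionK hx q).
apply: (u_mono hu hx); rewrite ?last_le ?le_pq ?last_ge //.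
by rewrite (first_le hx) // andbT; case/andP: (first_range hx s0).
Qed.

Lemma card_le_last_first s : s != set0 -> (#|s| <= (last_position s - first_position s).+1)%N.
Proof.
move=> s0; rewrite cardE -(size_map position).
have le_fl : (first_position s <= last_position s)%N.
  by rewrite (leq_trans (first_le hx (first_mem hx s0))) // last_ge // (first_mem hx).
rewrite -(size_iota (first_position s) (last_position s - first_position s).+1).
rewrite uniq_leq_size //.
  by rewrite map_inj_uniq ?enum_uniq //; apply: position_inj.
move=> i /mapP[v]; rewrite mem_enum => vs ->.
by rewrite mem_iota (first_le hx) //= addnS ltnS subnKC // last_ge.
Qed.

(** Of the [k + 2] vertices three are forced, namely [x i], its successor and [x j]; the other
    [k - 1] are chosen freely among the [j - i - 2] points strictly between the last two. *)
Lemma card_up_fiber k i j : (0 < k)%N -> (0 < i)%N -> (j <= n)%N ->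
  (k < j - i)%N ->
  #|[set s in up_simplices k.+1 | (first_position s, last_position s) == (i, j)]| =
  'C(j - i - 2, k - 1).
Proof.
move=> k0 i0 lejn ltk.
have lt_ij : (i.+1 < j)%N by lia.
pose M := [set v | (i.+1 < position v < j)%N].
pose C := [set x i; x i.+1; x j].
have pi : position (x i) = i by apply: (nthK hx); lia.
have pi1 : position (x i.+1) = i.+1 by apply: (nthK hx); lia.
have pj : position (x j) = j by apply: (nthK hx); lia.
have cardM : #|M| = (j - i - 2)%N.
  have uniqM : uniq [seq x m | m <- iota i.+2 (j - i - 2)].
    rewrite map_inj_in_uniq ?iota_uniq // => a b; rewrite !mem_iota => la lb.
    by move=> /(congr1 position); rewrite !(nthK hx) //; lia.
  rewrite -[RHS](size_iota i.+2) -(size_map x) -(card_uniqP uniqM).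
  apply: eq_card => v; rewrite inE; apply/idP/mapP => [lv|[m]].
    by exists (position v); rewrite ?(positionK hx) // mem_iota; lia.
  by rewrite mem_iota => lm ->; rewrite (nthK hx); lia.
have cardC : #|C| = 3.
  rewrite /C -setUA !cardsU1 cards1 !inE.
  have neq a b : position (x a) = a -> position (x b) = b -> a != b -> x a != x b.
    by move=> pa pb; apply: contraNneq => e; rewrite -pa e pb.
  by rewrite !(negPf (neq _ _ _ _ _)) //; lia.
have CM v : v \in C -> v \notin M.
  by rewrite !inE => /orP[/orP[]|] /eqP->; rewrite ?pi ?pi1 ?pj; lia.
have CM0 : C :&: M = set0.
  apply/setP => v; rewrite in_setI in_set0; apply/negbTE/negP => /andP[/CM/negP].
  exact.
have capUC (A : {set X}) : A \subset M -> (C :|: A) :&: M = A.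
  by move=> AM; rewrite setIUl CM0 set0U; apply/setIidPl.
have cardUC (A : {set X}) : A \subset M -> #|C :|: A| = #|A|.+3.
  move=> AM; rewrite cardsU cardC -(setIidPr AM) setIA CM0 set0I cards0 subn0.
  by rewrite (setIidPr AM).
(* The fiber is the image of the subsets [A] of [M] of size [k - 1] under union with the forced
   vertices [C]; intersecting with [M] recovers [A]. *)
rewrite -cardM -cards_draws -(card_in_imset (f := setU C)); last first.
  move=> A B; rewrite !inE => /andP[AM _] /andP[BM _] eqAB.
  by rewrite -(capUC A AM) eqAB capUC.
apply: eq_card => s; apply/idP/imsetP => [|[A]]; rewrite !inE.
  case/andP=> /andP[us /eqP card_s] /eqP[fs ls]; have s0 := up_neq0 us.
  have [_ xs1] := andP us; rewrite fs in xs1.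
  have sE : s = C :|: (s :&: M).
    apply/setP => v; rewrite in_setU in_setI; apply/idP/orP => [vs|[|/andP[]//]].
      rewrite vs; have := first_le hx vs; have := last_ge vs; rewrite fs ls => lej lei.
      have [vM|nM] := boolP (v \in M); [by right | left].
      rewrite !inE -!(inj_eq position_inj) pi pi1 pj; move: nM; rewrite inE; lia.
    rewrite !inE => /orP[/orP[]|] /eqP-> //.
      by rewrite -fs (first_mem hx).
    by rewrite -ls last_mem.
  exists (s :&: M) => //; rewrite inE subsetIr /=.
  by have := cardUC _ (subsetIr s M); rewrite -sE card_s; lia.
case/andP=> AM /eqP card_A ->; have C_M v : v \in C :|: A -> (i <= position v <= j)%N.
  case/setUP => [|/(subsetP AM)]; last by rewrite inE; lia.
  by rewrite !inE => /orP[/orP[]|] /eqP->; rewrite ?pi ?pi1 ?pj; lia.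
have fE : first_position (C :|: A) = i.
  apply: (first_eq hx); [lia | by rewrite !inE eqxx | by move=> v /C_M/andP[]].
have lE : last_position (C :|: A) = j.
  by apply: last_eq; [lia | by rewrite !inE eqxx !orbT | by move=> v /C_M/andP[]].
rewrite /up fE lE eqxx cardUC // !inE eqxx !orbT !andbT; lia.
Qed.

(** * Increasing tuples as up simplices *)

Section Tuples.
Variable k : nat.
Implicit Types (t : (k.+1).-tuple 'I_n.+1).

(** The added point is the predecessor of the smallest entry, so for an admissible tuple it becomes
    the first vertex and the smallest entry its successor. *)
Definition tuple_simplex t : {set X} :=
  x (tnth t ord0 - 1) |: [set x (val m) | m in t].

Definition admissible t := (2 <= tnth t ord0)%N && sorted ltn [seq val m | m <- t].

Lemma position_tuple t (m : 'I_n.+1) : admissible t -> m \in t ->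
  position (x m) = m.
Proof.
case/andP=> t2 sorted_t mt; apply: (nthK hx).
by have := sorted_tuple_bounds sorted_t mt; have := ltn_ord m; lia.
Qed.

Lemma position_tuple_pred t : admissible t ->
  position (x (tnth t ord0 - 1)%N) = (tnth t ord0 - 1)%N.
Proof.
by case/andP=> t2 _; apply: (nthK hx); have := ltn_ord (tnth t ord0); lia.
Qed.

Lemma tuple_simplexP t v : admissible t ->
  v \in tuple_simplex t ->
  position v = (tnth t ord0 - 1)%N \/
  exists2 m, m \in t & v = x (val m) /\ position v = m.
Proof.
move=> adm /setU1P[->|/imsetP[m mt ->]]; first by left; apply: position_tuple_pred.
by right; exists m; rewrite ?(position_tuple adm).
Qed.

Lemma first_tuple t : admissible t -> first_position (tuple_simplex t) = (tnth t ord0 - 1)%N.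
Proof.
move=> adm; have [t2 sorted_t] := andP adm; apply: (first_eq hx).
- by have := ltn_ord (tnth t ord0); lia.
- by rewrite inE set11.
- move=> v /(tuple_simplexP adm)[->//|[m mt [_ ->]]].
  by have := sorted_tuple_bounds sorted_t mt; lia.
Qed.

Lemma last_tuple t : admissible t -> last_position (tuple_simplex t) = tnth t ord_max.
Proof.
move=> adm; have [t2 sorted_t] := andP adm.
have max_t : tnth t ord_max \in t by apply: mem_tnth.
apply: last_eq.
- by have := ltn_ord (tnth t ord_max); have := sorted_tuple_bounds sorted_t max_t; lia.
- by rewrite inE; apply/orP; right; apply/imsetP; exists (tnth t ord_max).
- move=> v /(tuple_simplexP adm)[->|[m mt [_ ->]]].
    by have := sorted_tuple_bounds sorted_t max_t; lia.
  by have := sorted_tuple_bounds sorted_t mt; lia.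
Qed.

(** The entries are recovered as the labels of all vertices but the first; this gives
    injectivity. *)
Lemma mem_tuple_simplex t (m : 'I_n.+1) : admissible t ->
  (m \in t) = (first_position (tuple_simplex t) < m)%N && (x m \in tuple_simplex t).
Proof.
move=> adm; have [t2 sorted_t] := andP adm; rewrite first_tuple //.
apply/idP/andP => [mt|[lt_m]].
  split; first by have := sorted_tuple_bounds sorted_t mt; lia.
  by rewrite inE; apply/orP; right; apply/imsetP; exists m.
have pm : position (x m) = m by apply: (nthK hx); have := ltn_ord m; lia.
case/(tuple_simplexP adm) => [|[m' mt' [_]]]; rewrite pm; first by lia.
by move=> /ord_inj->.
Qed.

Lemma tuple_simplex_up t : admissible t -> tuple_simplex t \in up_simplices k.+1.
Proof.
move=> adm; have [t2 sorted_t] := andP adm; rewrite inE; apply/andP; split.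
  rewrite /up first_tuple //; have := ltn_ord (tnth t ord0) => lt_n.
  have -> : (tnth t ord0 - 1).+1 = tnth t ord0 by lia.
  rewrite inE; apply/andP; split; first by lia.
  by apply/orP; right; apply/imsetP; exists (tnth t ord0); rewrite ?mem_tnth.
have uniq_t : uniq t.
  by rewrite -(map_inj_uniq val_inj) (sorted_uniq ltn_trans ltnn).
rewrite cardsU1 card_in_imset => [|a b at' bt /(congr1 position)].
  rewrite (card_uniqP uniq_t) size_tuple.
  suff -> : x (tnth t ord0 - 1)%N \notin [set x (val m) | m in t] by [].
  apply/imsetP => -[m mt /(congr1 position)].
  rewrite (position_tuple adm mt) position_tuple_pred //.
  by have := sorted_tuple_bounds sorted_t mt; lia.
by rewrite !(position_tuple adm) // => /ord_inj.
Qed.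

Lemma tuple_simplex_inj : {in admissible &, injective tuple_simplex}.
Proof.
move=> t t' adm adm' e; apply/val_inj.
have [_ st] := andP adm; have [_ st'] := andP adm'.
(* Strictly increasing lists with the same members are equal. *)
apply: (inj_map val_inj); apply: (irr_sorted_eq ltn_trans ltnn) => // m.
suff tt' : t =i t' by apply: eq_mem_map.
by move=> a; rewrite !mem_tuple_simplex // e.
Qed.

(** The tuple lists in increasing order the labels of the vertices of [s] other than the first.
    Since [s] is up, its smallest entry is the label of the successor. *)
Lemma tuple_simplex_surj s : s \in up_simplices k.+1 ->
  exists2 t, admissible t & s = tuple_simplex t.
Proof.
rewrite inE => /andP[us /eqP card_s]; have s0 := up_neq0 us.
have [lt_fn fs] := andP us; have /andP[f0 _] := first_range hx s0.
pose l := [seq m <- enum 'I_n.+1 | (first_position s < val m)%N && (x (val m) \in s)].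
have pos_l (m : 'I_n.+1) : m \in l -> position (x m) = m.
  by rewrite mem_filter /= => /andP[/andP[ltm _] _]; apply: (nthK hx); have := ltn_ord m; lia.
have image_l : [set x (val m) | m in l] = s :\ x (first_position s).
  apply/setP => v; apply/imsetP/setD1P => [[m ml ->]|[nv vs]].
    split; last by move: ml; rewrite mem_filter => /andP[/andP[]].
    apply/eqP => /(congr1 position); rewrite pos_l // (nthK hx) ?(first_range hx) //.
    by move: ml; rewrite mem_filter /= => /andP[/andP[lt _] _] e; rewrite e ltnn in lt.
  have [p0 pn] := andP (position_le hx v).
  exists (Ordinal (pn : position v < n.+1)%N); rewrite /= ?(positionK hx) //.
  rewrite mem_filter mem_enum /= (positionK hx) vs !andbT ltn_neqAle (first_le hx) // andbT.
  by apply: contraNneq nv => ->; rewrite (positionK hx).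
have uniq_l : uniq l by rewrite filter_uniq ?enum_uniq.
have size_l : size l = k.+1.
  have := card_s; rewrite (cardsD1 (x (first_position s))) (first_mem hx) // -image_l.
  rewrite card_in_imset ?(card_uniqP uniq_l) => [[]//|a b al bl /(congr1 position)].
  by rewrite !pos_l // => /ord_inj.
pose t : (k.+1).-tuple 'I_n.+1 := Tuple (introT eqP size_l).
have sorted_t : sorted ltn [seq val m | m <- t].
  rewrite /= /l sorted_map; apply: sorted_filter => [a b c|]; first exact: ltn_trans.
  by rewrite -sorted_map val_enum_ord iota_ltn_sorted.
have t0 : tnth t ord0 = (first_position s).+1 :> nat.
  apply/eqP; rewrite eqn_leq; apply/andP; split; last first.
    by have := mem_tnth ord0 t; rewrite mem_filter => /andP[/andP[]].
  have ml : Ordinal (lt_fn : (first_position s).+1 < n.+1)%N \in t.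
    by rewrite mem_filter mem_enum /= fs ltnSn.
  by case/andP: (sorted_tuple_bounds sorted_t ml).
exists t; first by rewrite /admissible t0 sorted_t; lia.
by rewrite /tuple_simplex t0 subn1 /= image_l setD1K ?(first_mem hx).
Qed.

End Tuples.

Lemma perm_tuple_simplices k :
  perm_eq [seq tuple_simplex t | t : (k.+1).-tuple 'I_n.+1
      <- enum {: (k.+1).-tuple 'I_n.+1} & admissible t]
    (enum (up_simplices k.+1)).
Proof.
apply: uniq_perm; last 2 first.
- exact: enum_uniq.
- move=> s; rewrite mem_enum; apply/mapP/idP => [[t]|/tuple_simplex_surj[t adm ->]].
    by rewrite mem_filter => /andP[adm _] ->; apply: tuple_simplex_up.
  by exists t; rewrite // mem_filter adm mem_enum.
rewrite map_inj_in_uniq => [|t t']; first exact/filter_uniq/enum_uniq.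
by rewrite !mem_filter => /andP[adm _] /andP[adm' _]; apply: tuple_simplex_inj.
Qed.

Lemma perm_tuple_bars k :
  perm_eq [seq ephemeral_bar (u (x (tnth t ord0 - 1)%N) (x (tnth t ord_max)))
    | t : (k.+1).-tuple 'I_n.+1 <- enum {: (k.+1).-tuple 'I_n.+1} & admissible t]
    [seq ephemeral_bar (diam u s) | s <- enum (up_simplices k.+1)].
Proof.
apply: perm_trans _ (perm_map _ (perm_tuple_simplices k)); rewrite -map_comp.
apply: eq_perm; apply/eq_in_map => t; rewrite mem_filter => /andP[adm _] /=.
have := tuple_simplex_up adm; rewrite inE => /andP[/up_neq0 s0 _].
by rewrite diam_first_last // first_tuple // last_tuple.
Qed.

(** Grouping the up simplices by their first and last positions fixes the diameter in each group,
    and [card_up_fiber] gives the size of the group. *)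
Lemma perm_up_bars k : (0 < k)%N ->
  perm_eq [seq ephemeral_bar (diam u s) | s <- enum (up_simplices k.+1)]
    (flatten [seq nseq 'C(j - i - 2, k - 1) (ephemeral_bar (u (x i) (x j)))
      | i <- iota 1 n, j <- [seq j <- iota 1 n | (i < j)%N && (k + 1 <= j - i)%N]]).
Proof.
move=> k0; pose h (p : nat * nat) := ephemeral_bar (u (x p.1) (x p.2)).
pose L := [seq (i, j) | i <- iota 1 n,
  j <- [seq j <- iota 1 n | (i < j)%N && (k + 1 <= j - i)%N]].
have memL p : (p \in L) = [&& (0 < p.1)%N, (p.2 <= n)%N & (k < p.2 - p.1)%N].
  case: p => i j; apply/allpairsPdep/idP => [[a [b []]]|lij].
    by rewrite mem_filter !mem_iota => la lb [-> ->] /=; lia.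
  by exists i, j; rewrite mem_filter !mem_iota; split=> //; move: lij => /=; lia.
have uniqL : uniq L.
  apply: allpairs_uniq_dep; first exact: iota_uniq.
    by move=> i _; apply/filter_uniq/iota_uniq.
  by move=> [i j] [i' j'] _ _ /= [-> ->].
pose key s := (first_position s, last_position s).
(* The [k + 2] vertices have distinct positions between the first and the last, which forces a gap
   of at least [k + 1]. *)
have keyL : {in enum (up_simplices k.+1), forall s, key s \in L}.
  move=> s; rewrite mem_enum inE => /andP[/up_neq0 s0 /eqP card_s].
  have := card_le_last_first s0; rewrite memL card_s last_le.
  by case/andP: (first_range hx s0) => -> _ /=; lia.
have -> : [seq ephemeral_bar (diam u s) | s <- enum (up_simplices k.+1)] =
    [seq h (key s) | s <- enum (up_simplices k.+1)].
  apply/eq_in_map => s; rewrite mem_enum inE => /andP[/up_neq0 s0 _].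
  by rewrite diam_first_last.
apply: perm_trans (perm_fibers h uniqL keyL) _; rewrite /L map_allpairs.
apply: eq_perm; apply/(congr1 flatten)/eq_in_allpairs_dep => i.
rewrite mem_iota => li j; rewrite mem_filter mem_iota => lj.
by rewrite count_enum card_up_fiber //; lia.
Qed.

End UpSimplexCount.

Theorem theorem5 (F : fieldType) (R : realType) (X : finType)
    (u : X -> X -> R) (hu : is_ultrametric u)
    (n : nat) (x : nat -> X) (hx : self_consistent u n x)
    (k : nat) (hk : (1 <= k)%N) :
  let bars1 :=
    [seq ephemeral_bar (u (x (tnth i ord0 - 1)%N) (x (tnth i ord_max)))
    | i : (k.+1).-tuple 'I_n.+1 <- enum {: (k.+1).-tuple 'I_n.+1}
    & (2 <= tnth i ord0)%N && sorted ltn [seq val m | m <- i]] in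
  let bars2 :=
    flatten
      [seq nseq 'C(j - i - 2, k - 1) (ephemeral_bar (u (x i) (x j)))
      | i <- iota 1 n,
        j <- [seq j <- iota 1 n | (i < j)%N && (k + 1 <= j - i)%N]] in
  (forall B : seq (\bar R * \bar R),
     is_verbose_barcode F u k B <-> perm_eq B bars1) /\
  perm_eq bars1 bars2.
Proof.
(* Both multisets are compared with the diameters of the up simplices. *)
have perm12 := perm_tuple_bars hu hx k.
move=> bars1 bars2; split=> [B|].
  rewrite (verbose_barcode_up _ hu hx B hk); split=> permB.
    by rewrite (perm_trans permB) // perm_sym.
  exact: perm_trans permB perm12.
exact: perm_trans perm12 (perm_up_bars hu hx hk).
Qed.
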